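(* Let $k$ be a field, let $a\ge 1$, $d\ge 1$ and $b\in\{1,2,3\}$ be integers, put $m_0=3a+b$, $m_i=m_0+id$ for $i=1,2,3$, and assume $\gcd(m_0,m_1,m_2,m_3)=1$. Let $C$ be the monomial curve with parametrization $x_0=t^{m_0},\ x_1=t^{m_1},\ x_2=t^{m_2},\ y=t^{m_3}$, with defining ideal $I(C)\subset k[x_0,x_1,x_2,y]$ generated by the set $G$ given in the context. Then the defining ideal $I(C)^*$ of the tangent cone of $C$ at the origin is generated by the set $G^*=\{g^*: g\in G\}$ consisting of the least-degree homogeneous summands of the binomials in $G$.
   Context: $I(C)$ is the kernel of the $k$-algebra homomorphism $k[x_0,x_1,x_2,y]\to k[t]$, $x_0\mapsto t^{m_0}$, $x_1\mapsto t^{m_1}$, $x_2\mapsto t^{m_2}$, $y\mapsto t^{m_3}$. For a nonzero polynomial $f$, $f^*$ denotes its homogeneous summand of least degree (all variables have degree 1), and $I(C)^*$ is the ideal generated by all $f^*$ with $0\neq f\in I(C)$. Put $\xi_{11}=x_1^2-x_0x_2$, $\varphi_0=x_1x_2-x_0y$, $\varphi_1=x_2^2-x_1y$. The set $G$ is: if $b=1$, $G=\{\xi_{11},\varphi_0,\varphi_1,\ x_1y^a-x_0^{a+d+1},\ x_2y^a-x_0^{a+d}x_1,\ y^{a+1}-x_0^{a+d}x_2\}$; if $b=2$, $G=\{\xi_{11},\varphi_0,\varphi_1,\ x_2y^a-x_0^{a+d+1},\ y^{a+1}-x_0^{a+d}x_1\}$; if $b=3$, $G=\{\xi_{11},\varphi_0,\varphi_1,\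 y^{a+1}-x_0^{a+d+1}\}$. It is a known theorem (Patil) that $G$ is a minimal generating set of $I(C)$. *)

(* Defs.v *)
From mathcomp Require Import all_boot all_order all_algebra.
From mathcomp Require Export mpoly.

Set Implicit Arguments.
Unset Strict Implicit.
Unset Printing Implicit Defensive.

Import GRing.Theory.
Local Open Scope ring_scope.

(* The possibly improper ideal generated by S; the ideals of ring_quotient
   are required not to contain 1. *)
Definition ideal_gen (R : comNzRingType) (S : R -> Prop) (f : R) : Prop :=
  exists (r : nat) (c g : 'I_r -> R),
    (forall i, S (g i)) /\ f = \sum_(i < r) c i * g i.

(* Least degree of a monomial of f. As msize f is one more than the largest
   such degree, the default value of the minimum is reached only for f = 0. *)
Definition order_mpoly (n : nat) (R : nzRingType) (f : {mpoly R[n]}) : nat :=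
  \big[minn/msize f]_(m <- msupp f) mdeg m.

(* f^* (which is 0 for f = 0) *)
Definition initial_form (n : nat) (R : nzRingType) (f : {mpoly R[n]}) :
  {mpoly R[n]} := pihomog mdeg (order_mpoly f) f.

Section MonomialCurve.

Variable k : fieldType.

(* m_i = m_0 + i d with m_0 = 3 a + b; the variable y has index 3. *)
Definition curve_exponent (a d b : nat) (i : 'I_4) : nat := (3 * a + b + i * d)%N.

Definition curve_morphism (a d b : nat) : {mpoly k[4]} -> {poly k} :=
  mmap polyC (fun i : 'I_4 => 'X^(curve_exponent a d b i)).

Definition curve_ideal (a d b : nat) (f : {mpoly k[4]}) : Prop :=
  curve_morphism a d b f = 0.

Definition tangent_cone_ideal (I : {mpoly k[4]} -> Prop) : {mpoly k[4]} -> Prop :=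
  ideal_gen (fun h => exists f, [/\ f != 0, I f & h = initial_form f]).

Definition x0 : {mpoly k[4]} := 'X_(@Ordinal 4 0 isT).
Definition x1 : {mpoly k[4]} := 'X_(@Ordinal 4 1 isT).
Definition x2 : {mpoly k[4]} := 'X_(@Ordinal 4 2 isT).
Definition y  : {mpoly k[4]} := 'X_(@Ordinal 4 3 isT).

Definition xi11 : {mpoly k[4]} := x1 ^+ 2 - x0 * x2.
Definition phi0 : {mpoly k[4]} := x1 * x2 - x0 * y.
Definition phi1 : {mpoly k[4]} := x2 ^+ 2 - x1 * y.

(* Only meaningful for b = 1, 2, 3. *)
Definition patil_generators (a d b : nat) : seq {mpoly k[4]} :=
  match b with
  | 1 => [:: xi11; phi0; phi1;
             x1 * y ^+ a - x0 ^+ (a + d + 1);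
             x2 * y ^+ a - x0 ^+ (a + d) * x1;
             y ^+ (a + 1) - x0 ^+ (a + d) * x2]
  | 2 => [:: xi11; phi0; phi1;
             x2 * y ^+ a - x0 ^+ (a + d + 1);
             y ^+ (a + 1) - x0 ^+ (a + d) * x1]
  | 3 => [:: xi11; phi0; phi1;
             y ^+ (a + 1) - x0 ^+ (a + d + 1)]
  | _ => [::]
  end.

End MonomialCurve.

(* Main.v *)
Require Import Defs.
From mathcomp Require Import all_boot all_order all_algebra.
From mathcomp Require Import zify ring.

(** Each monomial of k[x_0,x_1,x_2,y] has a degree n and a slope
    s = e_1 + 2 e_2 + 3 e_3, and the parametrization sends it to t^(n m_0 + s d)
    ([curve_monomial]). Both numbers are preserved by the binomials xi_11, phi_0
    and phi_1, the equations of the twisted cubic; modulo these, a monomial is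
    therefore congruent to the monomial x_0^i x_r y^j, r in {0,1,2}, that has the
    same n and s, where the factor x_r is absent if r = 0
    ([monomial_reduction]). The least-degree summands of the other elements of G
    are y^(a+1) and the x_r y^a with b <= r <= 2, and a normal form x_0^i x_r y^j
    is divisible by one of them as soon as s = 3 j + r is at least
    m_0 = 3 a + b ([cubic_nf_mem]).

    Let f be in I(C), of order n. Modulo the ideal generated by G^*, the form f^*
    is thus a combination of the normal forms of degree n and slope s < m_0, the
    coefficient being the sum of the coefficients of f over the monomials of
    degree n and slope s. It remains to see that each such sum is 0
    ([initial_slope_sum0]). It is part of the coefficient of t^(n m_0 + s d) in
    the image of f, which vanishes, and it is all of that coefficient: a
    monomial of f with image t^(n m_0 + s d) has a degree n' >= n and a slope s' with
    (n' - n) m_0 = (s - s') d, so that 0 <= s - s' < m_0; as m_0 is prime to d,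
    it divides s - s', hence s' = s and n' = n.

    The converse inclusion holds because G lies in I(C). *)

Import GRing.Theory.
Local Open Scope ring_scope.

(** * Ideals given by generators *)

Section IdealGen.

Variables (R : comNzRingType) (S : R -> Prop).

Lemma ideal_gen_mem f : S f -> ideal_gen S f.
Proof.
by move=> Sf; exists 1, (fun=> 1), (fun=> f); rewrite big_ord1 mul1r.
Qed.

Lemma ideal_gen0 : ideal_gen S 0.
Proof. by exists 0, (fun=> 0), (fun=> 0); split; [case|rewrite big_ord0]. Qed.

Lemma ideal_genD f g : ideal_gen S f -> ideal_gen S g -> ideal_gen S (f + g).
Proof.
move=> [r [c [u [Su ->]]]] [r' [c' [u' [Su' ->]]]].
exists (r + r')%N.
exists (fun i => match split i with inl j => c j | inr j => c' j end).
exists (fun i => match split i with inl j => u j | inr j => u' j end).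
split; first by move=> i; case: (split i).
rewrite big_split_ord /=; congr (_ + _); apply: eq_bigr => i _.
  by rewrite (unsplitK (inl i : 'I_r + 'I_r')).
by rewrite (unsplitK (inr i : 'I_r + 'I_r')).
Qed.

Lemma ideal_genMl c f : ideal_gen S f -> ideal_gen S (c * f).
Proof.
move=> [r [e [u [Su ->]]]]; exists r, (fun i => c * e i), u; split=> //.
by rewrite big_distrr; apply: eq_bigr => i _; rewrite /= mulrA.
Qed.

Lemma ideal_gen_sum (I : Type) (s : seq I) (P : pred I) (F : I -> R) :
  (forall i, P i -> ideal_gen S (F i)) ->
  ideal_gen S (\sum_(i <- s | P i) F i).
Proof.
move=> SF; elim/big_ind: _ => //; [exact: ideal_gen0 | exact: ideal_genD].
Qed.

End IdealGen.

Lemma ideal_gen_sub (R : comNzRingType) (S T : R -> Prop) f :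
  (forall g, S g -> ideal_gen T g) -> ideal_gen S f -> ideal_gen T f.
Proof.
move=> ST [r [c [u [Su ->]]]]; apply: ideal_gen_sum => i _.
exact/ideal_genMl/ST.
Qed.

(** * Initial forms *)

Section InitialForm.

Variables (n : nat) (R : nzRingType).
Implicit Types f p q : {mpoly R[n]}.

Lemma order_mpoly_le f m : m \in msupp f -> (order_mpoly f <= mdeg m)%N.
Proof.
rewrite /order_mpoly; elim: (msupp f : seq _) => //= m' s IHs.
rewrite inE big_cons geq_min => /predU1P[->|/IHs ->]; first by rewrite leqnn.
by rewrite orbT.
Qed.

Lemma order_mpoly_eq f m : m \in msupp f ->
  (forall m', m' \in msupp f -> (mdeg m <= mdeg m')%N) ->
  order_mpoly f = mdeg m.
Proof.
move=> mf mmin; apply/eqP; rewrite eqn_leq order_mpoly_le //=.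
rewrite /order_mpoly big_seq; elim/big_ind: _ => [|i j|i /mmin //].
  exact/ltnW/msize_mdeg_lt.
by rewrite leq_min => -> ->.
Qed.

Lemma initial_form_add_homog d e p q : p \is d.-homog -> q \is e.-homog ->
  p != 0 -> (d < e)%N -> initial_form (p + q) = p.
Proof.
move=> hp hq p0 de.
have [m mp] : exists m, m \in msupp p.
  move: p0; rewrite -msupp_eq0; case: (msupp p : seq _) => // m s _.
  by exists m; rewrite inE eqxx.
have md : mdeg m = d := dhomog_mf hp mp.
have q0 : q@_m = 0 by apply: (dhomog_nemf_coeff hq); rewrite /= md ltn_eqF.
have ord : order_mpoly (p + q) = d.
  rewrite -md; apply: order_mpoly_eq.
    by rewrite mcoeff_msupp mcoeffD q0 addr0 -mcoeff_msupp.
  move=> m' /msuppD_le; rewrite mem_cat md => /orP[] m'in.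
    by rewrite (dhomog_mf hp m'in).
  by rewrite (dhomog_mf hq m'in) ltnW.
rewrite /initial_form ord pihomogD (pihomog_dE hp) (pihomog_ne0 _ hq) ?addr0 //.
by rewrite gtn_eqF.
Qed.

Lemma initial_form_homog d p : p \is d.-homog -> initial_form p = p.
Proof.
move=> hp; have [->|p0] := eqVneq p 0; first exact: pihomog0.
rewrite -[in LHS](addr0 p).
by apply: (@initial_form_add_homog d d.+1) => //; apply: dhomog0.
Qed.

End InitialForm.

(** * Reduction modulo the twisted cubic *)

Section MonomialCurve.

Variable k : fieldType.
Local Notation A := {mpoly k[4]}.
Local Notation x0 := (x0 k).
Local Notation x1 := (x1 k).
Local Notation x2 := (x2 k).
Local Notation y := (y k).

(** The weight of m for which x_0, x_1, x_2, y weigh 0, 1, 2, 3; as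
    m_i = m_0 + i d, it is what the image of m depends on besides the degree. *)
Definition slope (m : 'X_{1..4}) : nat := \sum_(i < 4) i * m i.

(** The monomial x_0^i x_r y^j, r < 3, of degree n and slope s. The power of y and
    the factor x_r, absent if r = 0, make together ceil(s / 3) factors, and the
    truncated subtraction is exact because s <= 3 n for every monomial. *)
Definition cubic_nf (n s : nat) : A :=
  x0 ^+ (n - (s + 2) %/ 3) * [:: 1; x1; x2]`_(s %% 3) * y ^+ (s %/ 3).

(** Rewriting x_1^2, x_1 x_2 and x_2^2 with the three binomials keeps the degree
    and the slope, and terminates because e_1 + e_2 decreases each time; it stops
    when e_1 + e_2 <= 1. *)
Lemma cubic_reduction (S : A -> Prop) (e0 e1 e2 e3 n s : nat) :
  S (xi11 k) -> S (phi0 k) -> S (phi1 k) ->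
  (n = e0 + e1 + e2 + e3)%N -> (s = e1 + 2 * e2 + 3 * e3)%N ->
  ideal_gen S (x0 ^+ e0 * x1 ^+ e1 * x2 ^+ e2 * y ^+ e3 - cubic_nf n s).
Proof.
move=> S1 S2 S3.
have step c e u v w : S c -> u = v + e * c ->
    ideal_gen S (v - w) -> ideal_gen S (u - w).
  move=> Sc -> Hv; rewrite addrAC.
  by apply: ideal_genD => //; apply/ideal_genMl/ideal_gen_mem.
have [N] := ubnP (e1 + e2); elim: N => // N IHN in e0 e1 e2 e3 *.
(* The monomials with e_1 + e_2 <= 1 are the normal forms. *)
have stop r : (r < 3)%N -> (n = e0 + (0 < r) + e3)%N -> (s = r + 3 * e3)%N ->
    ideal_gen S (x0 ^+ e0 * [:: 1; x1; x2]`_r * y ^+ e3 - cubic_nf n s).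
  move=> r3 en es; rewrite /cubic_nf.
  have -> : (s %% 3 = r)%N by lia.
  have -> : (s %/ 3 = e3)%N by lia.
  have -> : (n - (s + 2) %/ 3 = e0)%N by lia.
  by rewrite subrr; apply: ideal_gen0.
case: e1 => [|[|e1]] => [||lt en es].
- case: e2 => [|[|e2]] lt en es.
  + by have:= stop 0%N; rewrite !expr0 !mulr1; apply; lia.
  + by have:= stop 2%N; rewrite expr0 !mulr1; apply; lia.
  apply: (step _ (x0 ^+ e0 * x2 ^+ e2 * y ^+ e3) _
    (x0 ^+ e0 * x1 ^+ 1 * x2 ^+ e2 * y ^+ e3.+1) _ S3); last by apply: IHN; lia.
  by rewrite /phi1 !exprS; ring.
- case: e2 => [|e2] lt en es.
    by have:= stop 1%N; rewrite expr0 !mulr1; apply; lia.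
  apply: (step _ (x0 ^+ e0 * x2 ^+ e2 * y ^+ e3) _
    (x0 ^+ e0.+1 * x1 ^+ 0 * x2 ^+ e2 * y ^+ e3.+1) _ S2);
    last by apply: IHN; lia.
  by rewrite /phi0 !exprS; ring.
apply: (step _ (x0 ^+ e0 * x1 ^+ e1 * x2 ^+ e2 * y ^+ e3) _
  (x0 ^+ e0.+1 * x1 ^+ e1 * x2 ^+ e2.+1 * y ^+ e3) _ S1);
  last by apply: IHN; lia.
by rewrite /xi11 !exprS; ring.
Qed.

Lemma monomial_reduction (S : A -> Prop) (m : 'X_{1..4}) :
  S (xi11 k) -> S (phi0 k) -> S (phi1 k) ->
  ideal_gen S ('X_[m] - cubic_nf (mdeg m) (slope m)).
Proof.
move=> S1 S2 S3; rewrite mpolyXE_id mdegE /slope !big_ord_recl !big_ord0.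
rewrite mul0n mul1n !addn0 add0n !addnA mulr1 !mulrA.
have -> : 'X_ord0 = x0 by congr 'X_(_); apply: val_inj.
have -> : 'X_(lift ord0 ord0) = x1 by congr 'X_(_); apply: val_inj.
have -> : 'X_(lift ord0 (lift ord0 ord0)) = x2 by congr 'X_(_); apply: val_inj.
have -> : 'X_(lift ord0 (lift ord0 (lift ord0 ord0))) = y.
  by congr 'X_(_); apply: val_inj.
by apply: cubic_reduction => //; rewrite /= /bump; lia.
Qed.

(** * The initial forms of Patil's generators *)

(** Dropping the first b - 1 monomials leaves y^(a+1) and the x_r y^a with
    b <= r <= 2, whatever b in {1,2,3} is. *)
Definition tangent_cone_generators (a b : nat) : seq A :=
  [:: xi11 k, phi0 k, phi1 k
    & drop b.-1 [:: x1 * y ^+ a; x2 * y ^+ a; y ^+ (a + 1)]].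

(** Write s = 3 j + r with r < 3. As s >= 3 a + b and b >= 1, either j >= a + 1,
    and y^(a+1) divides the normal form, or j = a and r >= b, and x_r y^a does. *)
Lemma cubic_nf_mem (a b n s : nat) : b \in [:: 1; 2; 3]%N ->
  (3 * a + b <= s)%N ->
  ideal_gen (fun h => h \in tangent_cone_generators a b) (cubic_nf n s).
Proof.
move=> hb hs; set S := fun h => _; rewrite /cubic_nf.
have [lt|ge] := ltnP a (s %/ 3).
  have Sy : S (y ^+ (a + 1)).
    by move: hb; rewrite /S !inE => /or3P[]/eqP->; rewrite /= ?inE eqxx ?orbT.
  have -> : (s %/ 3 = (s %/ 3 - (a + 1)) + (a + 1))%N by lia.
  by rewrite exprD mulrA; apply/ideal_genMl/ideal_gen_mem.
have -> : (s %/ 3 = a)%N by move: hb; rewrite !inE; lia.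
rewrite -mulrA; apply/ideal_genMl/ideal_gen_mem.
have : (b <= s %% 3)%N by move: hb; rewrite !inE; lia.
have: (s %% 3 < 3)%N by rewrite ltn_mod.
by move: hb; rewrite /S !inE => /or3P[]/eqP->;
  case: (s %% 3)%N => [|[|[]]] //= _ _; rewrite ?inE eqxx ?orbT.
Qed.

Lemma homogU i : ('X_i : A) \is 1.-homog.
Proof. by rewrite dhomogX /= mdeg1. Qed.

Lemma homogM2 i j : ('X_i * 'X_j : A) \is 2.-homog.
Proof. by rewrite -[2%N]/(1 + 1)%N; apply: dhomogM; apply: homogU. Qed.

Lemma mpolyU_neq0 i : ('X_i : A) != 0.
Proof. by rewrite -msupp_eq0 msuppX. Qed.

(** The first three generators are homogeneous; in each of the others the second
    monomial has degree a + d + 1, which exceeds the degree a + 1 of the first one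
    because d is positive. *)
Lemma patil_initial_forms (a d b : nat) : (1 <= d)%N ->
  b \in [:: 1; 2; 3]%N ->
  [seq initial_form g | g <- patil_generators k a d b]
  = tangent_cone_generators a b.
Proof.
move=> hd hb.
have hom2 : (initial_form (xi11 k) = xi11 k)
    * (initial_form (phi0 k) = phi0 k) * (initial_form (phi1 k) = phi1 k).
  by do !split; apply: (@initial_form_homog _ _ 2);
    apply: rpredB; apply: homogM2.
have homX i n : ('X_i : A) ^+ n \is n.-homog.
  by rewrite -[X in X.-homog]mul1n; apply: dhomogMn; apply: homogU.
have hom1 n p q : p \is (a + 1)%N.-homog -> p != 0 ->
    q \is n.-homog -> (a + 1 < n)%N -> initial_form (p - q) = p :> A.
  by move=> hp p0 hq lt; apply: initial_form_add_homog hp _ p0 lt; rewrite rpredN.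
have hXY i : 'X_i * y ^+ a \is (a + 1)%N.-homog.
  by rewrite addnC; apply: dhomogM; [apply: homogU|apply: homX].
have nXY i : 'X_i * y ^+ a != 0 by rewrite mulf_neq0 ?expf_neq0 ?mpolyU_neq0.
have hX i : x0 ^+ (a + d) * 'X_i \is (a + d + 1)%N.-homog.
  by apply: dhomogM; [apply: homX|apply: homogU].
have lt : (a + 1 < a + d + 1)%N by lia.
have hY : y ^+ (a + 1) \is (a + 1)%N.-homog := homX _ _.
have nY : y ^+ (a + 1) != 0 by rewrite expf_neq0 ?mpolyU_neq0.
have h0 : x0 ^+ (a + d + 1) \is (a + d + 1)%N.-homog := homX _ _.
move: hb; rewrite !inE => /or3P[]/eqP->;
  rewrite /tangent_cone_generators /= !hom2 ?(hom1 _ _ _ _ _ h0 lt) //;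
  by rewrite /Defs.x1 /Defs.x2 ?(hom1 _ _ _ _ _ (hX _) lt).
Qed.

(** * Elements of the curve ideal *)

Lemma curve_monomial (a d b : nat) (m : 'X_{1..4}) :
  mmap1 (fun i : 'I_4 => 'X^(curve_exponent a d b i)) m
  = 'X^((3 * a + b) * mdeg m + slope m * d) :> {poly k}.
Proof.
rewrite /mmap1 mdegE /slope big_distrr big_distrl -big_split /=.
rewrite (big_morph (fun n => 'X^n : {poly k}) (fun i j => exprD _ i j) (expr0 _)).
by apply: eq_bigr => i _; rewrite -exprM /curve_exponent; congr 'X^_; ring.
Qed.

Lemma coef_curve_morphism (a d b N : nat) (f : A) :
  (curve_morphism a d b f)`_N =
  \sum_(m <- msupp f | (3 * a + b) * mdeg m + slope m * d == N) f@_m.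
Proof.
rewrite /curve_morphism /mmap coef_sum [RHS]big_mkcond; apply: eq_bigr => m _.
by rewrite curve_monomial coefCM coefXn eq_sym; case: eqP; rewrite ?mulr1 ?mulr0.
Qed.

(** A common divisor of m_0 and d divides every m_i = m_0 + i d. *)
Lemma curve_exponent_coprime (a d b : nat) :
  \big[gcdn/0%N]_(i < 4) curve_exponent a d b i = 1%N -> coprime (3 * a + b) d.
Proof.
move=> hgcd; rewrite /coprime -dvdn1; rewrite -[X in (_ %| X)%N]hgcd.
apply/dvdn_biggcdP => i _.
by apply: dvdn_add; [apply: dvdn_gcdl | apply/dvdn_mull/dvdn_gcdr].
Qed.

(** The coefficient of t^(n m_0 + s d) in the image of f, where n is the order of
    f, only receives contributions from the monomials of degree n and slope s: no
    monomial of f has a smaller degree, and one of larger degree would have a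
    slope congruent to s modulo m_0 and smaller than s, which s < m_0 excludes. *)
Lemma initial_slope_sum0 (a d b s : nat) (f : A) : (0 < d)%N ->
  coprime (3 * a + b) d -> curve_ideal a d b f -> (s < 3 * a + b)%N ->
  \sum_(m <- msupp f | (mdeg m == order_mpoly f) && (slope m == s)) f@_m = 0.
Proof.
set m0 := (3 * a + b)%N => hd cop If lt; set n := order_mpoly f.
have := congr1 (fun p : {poly k} => p`_(m0 * n + s * d)) If.
rewrite /= coef0 coef_curve_morphism -/m0 => c0.
rewrite -[RHS]c0 big_seq_cond [RHS]big_seq_cond; apply: eq_bigl => m.
case mf : (m \in msupp f) => //=.
have le := order_mpoly_le _ _ _ _ mf; rewrite -/n in le.
apply/andP/eqP => [[/eqP-> /eqP->] //|e].
have s_le : (slope m <= s)%N by rewrite -(leq_pmul2r hd); nia.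
have e' : ((mdeg m - n) * m0 = (s - slope m) * d)%N by nia.
have dvd : (m0 %| s - slope m)%N by rewrite -(Gauss_dvdl _ cop) -e' dvdn_mull.
have s_eq : slope m = s.
  apply/eqP; rewrite eqn_leq s_le -subn_eq0 /=; apply: contraTT dvd => pos.
  by rewrite gtnNdvd ?lt0n // (leq_ltn_trans (leq_subr _ _) lt).
split; last exact/eqP.
move: e'; rewrite s_eq subnn mul0n => /eqP; rewrite muln_eq0 => /orP[dn|]; lia.
Qed.

Lemma initial_form_mem (a d b : nat) (f : A) : (0 < d)%N ->
  b \in [:: 1; 2; 3]%N -> coprime (3 * a + b) d -> curve_ideal a d b f ->
  ideal_gen (fun h => h \in tangent_cone_generators a b) (initial_form f).
Proof.
move=> hd hb cop If; set S := fun h => _; set m0 := (3 * a + b)%N.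
set n := order_mpoly f.
have [S1 S2 S3] : [/\ S (xi11 k), S (phi0 k) & S (phi1 k)].
  by rewrite /S; split; rewrite !inE eqxx ?orbT.
(* X^m is congruent to nf m modulo S for every m of degree n. *)
pose nf m := if (slope m < m0)%N then cubic_nf n (slope m) else 0.
(* Group the terms by slope: each group has coefficient sum 0. *)
have nf0 : \sum_(m <- msupp f | mdeg m == n) f@_m *: nf m = 0.
  transitivity (\sum_(m <- msupp f | mdeg m == n)
      \sum_(s < m0 | slope m == s) f@_m *: cubic_nf n s).
    apply: eq_bigr => m _; rewrite /nf; case: ltnP => [lt|ge].
      by rewrite (big_pred1 (Ordinal lt)) // => i; rewrite eq_sym.
    rewrite scaler0 big_pred0 // => i; apply: gtn_eqF.
    exact: leq_trans (ltn_ord i) ge.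
  rewrite (exchange_big_dep predT) //= big1 // => s _.
  by rewrite -scaler_suml (initial_slope_sum0 a d b) ?scale0r.
have -> : initial_form f =
    \sum_(m <- msupp f | mdeg m == n) f@_m *: ('X_[m] - nf m).
  under eq_bigr => m _ do rewrite scalerBr.
  by rewrite sumrB nf0 subr0 /initial_form pihomogE.
apply: ideal_gen_sum => m /eqP dm.
rewrite -mul_mpolyC; apply: ideal_genMl.
rewrite -[_ - _](subrKA (cubic_nf n (slope m))) -dm.
apply: ideal_genD; first exact: monomial_reduction.
rewrite /nf -dm; case: ltnP => [_|ge]; first by rewrite subrr; apply: ideal_gen0.
by rewrite subr0; apply: cubic_nf_mem.
Qed.

Lemma patil_generators_curve_ideal (a d b : nat) g :
  g \in patil_generators k a d b -> curve_ideal a d b g.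
Proof.
have wX i : mmap polyC (fun j : 'I_4 => 'X^(curve_exponent a d b j)) 'X_i
    = 'X^(3 * a + b + i * d) :> {poly k} by rewrite mmapX mmap1U.
rewrite /curve_ideal /curve_morphism.
case: b wX => [|[|[|[|b]]]] wX //=; rewrite !inE;
  do ?[case/orP]; move/eqP->;
  rewrite /xi11 /phi0 /phi1 /Defs.x0 /Defs.x1 /Defs.x2 /Defs.y;
  rewrite rmorphB ?rmorphM ?rmorphXn /= !wX;
  rewrite -?exprM -?exprD; apply/eqP; rewrite subr_eq0; apply/eqP; congr ('X^_);
  rewrite /=; lia.
Qed.

End MonomialCurve.

Theorem proposition2p4 (k : fieldType) (a d b : nat)
    (ha : (1 <= a)%N) (hd : (1 <= d)%N) (hb : b \in [:: 1; 2; 3]%N)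
    (hgcd : \big[gcdn/0%N]_(i < 4) curve_exponent a d b i = 1%N)
    (f : {mpoly k[4]}) :
  tangent_cone_ideal (curve_ideal (k := k) a d b) f <->
  ideal_gen (fun h => h \in [seq initial_form g | g <- patil_generators k a d b]) f.
Proof.
split; apply: ideal_gen_sub => h.
  case=> g [_ Ig ->]; rewrite patil_initial_forms //.
  exact/initial_form_mem/Ig/curve_exponent_coprime.
(* The tangent cone ideal is generated by initial forms of nonzero elements. *)
case/mapP => g gG ->; have [->|g0] := eqVneq g 0.
  by rewrite (@initial_form_homog _ _ 0) ?dhomog0 //; apply: ideal_gen0.
apply: ideal_gen_mem; exists g; split=> //.
exact: patil_generators_curve_ideal gG.
Qed.
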